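(* Let $E$ be a quadratic word equation over constants $A$ and with set of variables $V$, and let $\mathcal{C}(E)$ be the counter system defined below. Then the length abstraction of $E$ equals $$\{ v \in \mathbb{N}^{V} : (E, v) \in \mathrm{pre}^*_{\mathcal{C}(E)}(\{\epsilon=\epsilon\}\times \mathbb{N}^{V})\},$$ where $\epsilon=\epsilon$ denotes the equation whose both sides are empty.
   Context: A word equation is $L=R$ with $L,R\in(A\cup V)^*$ ($A$ finite alphabet of constants, $V$ variables, disjoint); a solution is a homomorphism $\sigma$ fixing constants with $\sigma(L)=\sigma(R)$; it is quadratic if each variable occurs at most twice in total. The length abstraction of $E$ is the set of vectors $(|\sigma(x)|)_{x\in V}\in\mathbb{N}^V$ over all solutions $\sigma$. For words $w,u$ and a variable $y$, $w[u/y]$ is $w$ with every occurrence of $y$ replaced by $u$. Nielsen rewriting: for $E$ of the form $\alpha w_1=\beta w_2$ with $\alpha,\beta\in A\cup V$, $w_1,w_2\in(A\cup V)^*$, we have $E\Rightarrow E'$ in the following cases: (erase) if $\alpha\in V$, $E'$ is $(w_1=\beta w_2)[\epsilon/\alpha]$, and symmetrically if $\beta\in V$, $E'$ is $(\alpha w_1 = w_2)[\epsilon/\beta]$; (P1) if $\alpha$ and $\beta$ are the same symbol, $E'$ is $w_1=w_2$; (P2) if $\alpha\in A,\beta\in V$, $E'$ is $w_1[\alpha\beta/\beta]=\beta\, w_2[\alpha\beta/\beta]$; (P3) if $\alpha\in V,\beta\in A$, $E'$ is $\alpha\, w_1[\beta\alpha/\alpha]=w_2[\beta\alpha/\alpha]$;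 (P4) if $\alpha,\beta$ are distinct variables, $E'$ is either $w_1[\alpha\beta/\beta]=\beta\, w_2[\alpha\beta/\beta]$ (case ''$\alpha\preceq\beta$'') or $\alpha\, w_1[\beta\alpha/\alpha]=w_2[\beta\alpha/\alpha]$ (case ''$\beta\preceq\alpha$''). Counter systems: a counter system is $(X,Q,\Delta)$ with $X$ a finite set of counters, $Q$ a finite set of control states and $\Delta$ a finite set of transitions $(q,\Phi(\bar x,\bar x'),q')$ where $\Phi$ is a Presburger formula over the current values $\bar x$ and next values $\bar x'$ of the counters. Configurations are pairs $(q,v)\in Q\times\mathbb{N}^X$, and $(q,v)\to(q',v')$ iff some transition $(q,\Phi,q')$ has $\Phi(v,v')$ true. For a set $T$ of configurations, $\mathrm{pre}^*(T)$ is the set of configurations from which some configuration in $T$ is reachable in zero or more steps. Formulas: $\mathrm{ID}$ is $\bigwedge_{x\in X} x'=x$; $\mathrm{SUB}_{y,z}$ is $0<z\le y \wedge y'=y-z\wedge\bigwedge_{x\neq y}x'=x$; $\mathrm{DEC}_y$ is $y>0\wedge y'=y-1\wedge\bigwedge_{x\ne y}x'=x$. The counter system $\mathcal{C}(E)$ has counters $V$, control states all equations $E'$ with $E\Rightarrow^*E'$, and for each step $E_1\Rightarrow E_2$ between control states a transition $(E_1,\Phi,E_2)$ where: if the step erases variable $y$, $\Phi$ is $y=0\wedge\mathrm{ID}$; for (P1), $\Phi=\mathrm{ID}$; for (P2), $\Phi=\mathrm{DEC}_\beta$; for (P3), $\Phi=\mathrm{DEC}_\alpha$; for (P4) in case $\alpha\preceq\beta$,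 $\Phi=\mathrm{SUB}_{\beta,\alpha}$, and in case $\beta\preceq\alpha$, $\Phi=\mathrm{SUB}_{\alpha,\beta}$.
   Formalization: The erase rule is also allowed when the other side of the equation is empty (otherwise x = ε is stuck and the claim fails), and the alphabet A is assumed nonempty (otherwise ε = ε with a variable is a counterexample). *)

(* Defs.v *)
From mathcomp Require Import all_boot zify.
From mathcomp Require Import boolp classical_sets functions cardinality.
From Stdlib Require Import Relation_Operators.

Set Implicit Arguments.
Unset Strict Implicit.
Unset Printing Implicit Defensive.

Local Open Scope classical_set_scope.

Inductive term (F : Type) : Type :=
| Var of F
| Num of nat
| Add of term F & term F.

Arguments Num {F} n.

(* [formula F] has its free variables in [F]; a quantifier binds [None]. *)
Inductive formula (F : Type) : Type :=
| Eq of term F & term F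
| Le of term F & term F
| Not of formula F
| And of formula F & formula F
| Ex of formula (option F).

Definition Lt F (s t : term F) : formula F := Le (Add s (Num 1)) t.
Definition Top {F} : formula F := Eq (Num 0) (Num 0).

Fixpoint teval (F : Type) (e : F -> nat) (t : term F) : nat :=
  match t with
  | Var x => e x
  | Num n => n
  | Add s t => teval e s + teval e t
  end.

Fixpoint sat (F : Type) (phi : formula F) : (F -> nat) -> Prop :=
  match phi with
  | Eq s t => fun e => teval e s = teval e t
  | Le s t => fun e => teval e s <= teval e t
  | Not f => fun e => ~ sat f e
  | And f g => fun e => sat f e /\ sat g e
  | Ex f => fun e => exists n : nat, sat f (fun o => oapp e n o)
  end.

(* Relations between current values ([inl]) and next values ([inr]). *)
Definition update (X : finType) := formula (X + X).

Definition sat_update (X : finType) (phi : update X) (v v' : X -> nat) : Prop :=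
  sat phi (fun s => match s with inl x => v x | inr x => v' x end).

Record counter_system (X : finType) (S : Type) := CounterSystem {
  states : set S;
  transitions : set (S * update X * S);
  transitions_states : forall q phi q',
    transitions (q, phi, q') -> states q /\ states q';
  states_finite : finite_set states;
  transitions_finite : finite_set transitions }.

Section Reachability.
Variables (X : finType) (S : Type) (C : counter_system X S).

Definition cs_config : set (S * (X -> nat)) := states C `*` setT.

Definition cs_step (c c' : S * (X -> nat)) : Prop :=
  exists phi, transitions C (c.1, phi, c'.1) /\ sat_update phi c.2 c'.2.

Definition pre_star (T : set (S * (X -> nat))) : set (S * (X -> nat)) :=
  [set c | cs_config c /\ exists2 c', T c' & clos_refl_trans _ cs_step c c'].

End Reachability.

Section Updates.
Variable X : finType.
Implicit Types y z : X.

Definition cur y : term (X + X) := Var (inl y).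
Definition nxt y : term (X + X) := Var (inr y).

Definition ID : update X :=
  \big[@And _/Top]_(x : X) Eq (nxt x) (cur x).

Definition unchanged_except y : update X :=
  \big[@And _/Top]_(x : X | x != y) Eq (nxt x) (cur x).

(* Since [z <= y], the equation [y' = y - z] is the same as [y' + z = y]. *)
Definition SUB y z : update X :=
  And (And (Lt (Num 0) (cur z)) (Le (cur z) (cur y)))
      (And (Eq (Add (nxt y) (cur z)) (cur y)) (unchanged_except y)).

Definition DEC y : update X :=
  And (Lt (Num 0) (cur y))
      (And (Eq (Add (nxt y) (Num 1)) (cur y)) (unchanged_except y)).

Definition ZERO y : update X := And (Eq (cur y) (Num 0)) ID.

End Updates.

Section WordEquations.
Variables A V : finType.

Definition word := seq (A + V).
Definition equation : Type := word * word.

Definition quadratic (E : equation) : Prop :=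
  forall x : V, count_mem (inr x) (E.1 ++ E.2) <= 2.

Record solution (E : equation) (h : word -> seq A) : Prop := Solution {
  solution_nil : h [::] = [::];
  solution_cat : forall u w, h (u ++ w) = h u ++ h w;
  solution_const : forall a, h [:: inl a] = [:: a];
  solution_eq : h E.1 = h E.2 }.

Definition length_abstraction (E : equation) : set (V -> nat) :=
  [set (fun x => size (h [:: inr x])) | h in solution E].

Definition subst (y : V) (u w : word) : word :=
  flatten [seq (if s == inr y then u else [:: s]) | s <- w].

Inductive rule :=
| Erase of V
| Cancel
| StripConst of V
| StripVar of V & V.

(* [StripConst y]: [y] starts with the constant at the head of the other side.
   [StripVar x y]: [x] is a prefix of [y].
   Erasing applies to the head variable of a side even when the other side is
   empty; otherwise an equation such as [x = epsilon] would be stuck. *)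
Inductive nielsen : rule -> equation -> equation -> Prop :=
| Nielsen_erase_l x w1 w2 :
    nielsen (Erase x) (inr x :: w1, w2) (subst x [::] w1, subst x [::] w2)
| Nielsen_erase_r y w1 w2 :
    nielsen (Erase y) (w1, inr y :: w2) (subst y [::] w1, subst y [::] w2)
| Nielsen_cancel s w1 w2 :
    nielsen Cancel (s :: w1, s :: w2) (w1, w2)
| Nielsen_const_l a y w1 w2 :
    nielsen (StripConst y) (inl a :: w1, inr y :: w2)
      (subst y [:: inl a; inr y] w1, inr y :: subst y [:: inl a; inr y] w2)
| Nielsen_const_r x b w1 w2 :
    nielsen (StripConst x) (inr x :: w1, inl b :: w2)
      (inr x :: subst x [:: inl b; inr x] w1, subst x [:: inl b; inr x] w2)
| Nielsen_var_l x y w1 w2 : x <> y ->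
    nielsen (StripVar x y) (inr x :: w1, inr y :: w2)
      (subst y [:: inr x; inr y] w1, inr y :: subst y [:: inr x; inr y] w2)
| Nielsen_var_r x y w1 w2 : x <> y ->
    nielsen (StripVar y x) (inr x :: w1, inr y :: w2)
      (inr x :: subst x [:: inr y; inr x] w1, subst x [:: inr y; inr x] w2).

Definition rewrites (E E' : equation) : Prop := exists r, nielsen r E E'.

Definition reachable (E : equation) : set equation :=
  [set E' | clos_refl_trans _ rewrites E E'].

Definition guard (r : rule) : update V :=
  match r with
  | Erase y => ZERO y
  | Cancel => ID V
  | StripConst y => DEC y
  | StripVar x y => SUB y x
  end.

Definition nielsen_transitions (E : equation) : set (equation * update V * equation) :=
  [set t | [/\ reachable E t.1.1, reachable E t.2 &
     exists2 r, nielsen r t.1.1 t.2 & t.1.2 = guard r]].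

Fact occ_key : unit. Proof. exact: tt. Qed.
Definition occ (y : V) : word -> nat := locked_with occ_key (count_mem (inr y)).
Definition total (E : equation) := size E.1 + size E.2.

Lemma occE y w : occ y w = count_mem (inr y) w.
Proof. by rewrite /occ unlock. Qed.

Lemma occ_nil y : occ y [::] = 0.
Proof. by rewrite occE. Qed.

Lemma occ_const y a w : occ y (inl a :: w) = occ y w.
Proof. by rewrite !occE. Qed.

Lemma occ_var y x w : occ y (inr x :: w) = (y == x) + occ y w.
Proof. by rewrite !occE /= (inj_eq inr_inj) eq_sym. Qed.

Lemma subst_var y u w : subst y u (inr y :: w) = u ++ subst y u w.
Proof. by rewrite /subst /= eqxx. Qed.

Lemma subst_other y u s w : s != inr y -> subst y u (s :: w) = s :: subst y u w.
Proof. by rewrite /subst /= => /negbTE ->. Qed.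

Lemma occ_subst z y u w :
  occ z (subst y u w) = (if z == y then 0 else occ z w) + occ y w * occ z u.
Proof.
elim: w => [|s w IH]; first by rewrite !occ_nil if_same.
have [->|ne] := eqVneq s (inr y).
  rewrite subst_var occE count_cat -!occE IH !occ_var eqxx.
  by case: (eqVneq z y) => [->|] /=; lia.
rewrite subst_other //; case: s ne => [a|x] ne; first by rewrite !occ_const.
have {ne} /negbTE ne : y != x by apply: contraNneq ne => ->.
rewrite !occ_var IH ne; case: (eqVneq z y) => [->|]; rewrite ?ne; lia.
Qed.

Lemma size_subst y u w : size (subst y u w) + occ y w = size w + occ y w * size u.
Proof.
elim: w => [|s w IH]; first by rewrite occ_nil.
have [->|ne] := eqVneq s (inr y).
  by rewrite subst_var size_cat occ_var eqxx /=; lia.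
rewrite subst_other //; case: s ne => [a|x] ne; rewrite ?occ_const ?occ_var /=.
  by lia.
by have {ne} /negbTE -> : y != x; [apply: contraNneq ne => -> | lia].
Qed.

Lemma quadraticP (E : equation) :
  quadratic E <-> forall x, occ x E.1 + occ x E.2 <= 2.
Proof. by split=> H x; move: (H x); rewrite count_cat !occE. Qed.

Lemma nielsen_bounded r E E' : nielsen r E E' -> quadratic E ->
  quadratic E' /\ total E' <= total E.
Proof.
move=> st /quadraticP qE; suff: (forall z, occ z E'.1 + occ z E'.2 <=
    occ z E.1 + occ z E.2) /\ total E' <= total E.
  by case=> H ?; split=> //; apply/quadraticP => x; apply: leq_trans (qE x).
have occs := (occ_subst, occ_var, occ_const, occ_nil).
case: st qE => [x w1 w2|y w1 w2|s w1 w2|a y w1 w2|x b w1 w2|x y w1 w2 nxy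
  |x y w1 w2 nxy] /= qE.
- split=> [z|]; first by rewrite !occs; case: ifP; lia.
  by rewrite /total /=; have /= := size_subst x [::] w1;
    have /= := size_subst x [::] w2; lia.
- split=> [z|]; first by rewrite !occs; case: ifP; lia.
  by rewrite /total /=; have /= := size_subst y [::] w1;
    have /= := size_subst y [::] w2; lia.
- by split=> [z|]; [case: s qE => s _; rewrite !occs | rewrite /total /=]; lia.
- have := qE y; rewrite !occs eqxx => qy; split=> [z|].
    by rewrite !occs; case: (eqVneq z y) => [->|]; lia.
  by rewrite /total /=; have /= := size_subst y [:: inl a; inr y] w1;
    have /= := size_subst y [:: inl a; inr y] w2; lia.
- have := qE x; rewrite !occs eqxx => qx; split=> [z|].
    by rewrite !occs; case: (eqVneq z x) => [->|]; lia.
  by rewrite /total /=; have /= := size_subst x [:: inl b; inr x] w1;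
    have /= := size_subst x [:: inl b; inr x] w2; lia.
- have := qE y; rewrite !occs eqxx => qy; split=> [z|].
    rewrite !occs; case: (eqVneq z y) => [->|]; first by lia.
    by case: (eqVneq z x) => [->|]; lia.
  by rewrite /total /=; have /= := size_subst y [:: inr x; inr y] w1;
    have /= := size_subst y [:: inr x; inr y] w2; lia.
- have := qE x; rewrite !occs eqxx => qx; split=> [z|].
    rewrite !occs; case: (eqVneq z x) => [->|]; first by lia.
    by case: (eqVneq z y) => [->|]; lia.
  by rewrite /total /=; have /= := size_subst x [:: inr y; inr x] w1;
    have /= := size_subst x [:: inr y; inr x] w2; lia.
Qed.

Lemma reachable_bounded E E' : quadratic E -> reachable E E' ->
  quadratic E' /\ total E' <= total E.
Proof.
move=> + rE; elim: rE => {E E'} [E E' [r] /nielsen_bounded|E|E F G _ IH1 _ IH2] qE;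
  [exact|by []|].
have [qF leF] := IH1 qE; have [qG leG] := IH2 qF.
by split=> //; apply: leq_trans leF.
Qed.

Lemma reachable_finite E : quadratic E -> finite_set (reachable E).
Proof.
move=> qE; set n := total E.
have fin : finite_set ((fun p : n.-bseq (A + V)%type * n.-bseq (A + V)%type =>
    (val p.1, val p.2) : equation) @` setT) by exact/finite_image/finite_finset.
apply: sub_finite_set fin => -[w1 w2] /(reachable_bounded qE)[_].
rewrite /total /= -/(total E) -/n => le_n.
have le1 : size w1 <= n by lia.
have le2 : size w2 <= n by lia.
by exists (Bseq le1, Bseq le2).
Qed.

Lemma guard_finite : finite_set (range guard).
Proof.
have f1 (f : V -> update V) : finite_set (range f) by exact/finite_image/finite_finset.
have f2 : finite_set (range (fun p : V * V => SUB p.2 p.1)).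
  exact/finite_image/finite_finset.
suff : range guard `<=` range (@ZERO V) `|` [set ID V] `|` range (@DEC V)
    `|` range (fun p : V * V => SUB p.2 p.1).
  by move/sub_finite_set; apply; rewrite !finite_setU; do !split.
move=> _ [[y||y|x y] _ <-] /=; [do 3 left|do 2 left; right|left; right|right].
- by exists y.
- by [].
- by exists y.
- by exists (x, y).
Qed.

Lemma nielsen_transitions_finite E :
  quadratic E -> finite_set (nielsen_transitions E).
Proof.
move=> /reachable_finite fE.
apply: sub_finite_set (finite_setX (finite_setX fE guard_finite) fE).
by move=> [[E1 phi] E2] [/= r1 r2 [r _ ->]]; do !split=> //; exists r.
Qed.

Lemma nielsen_transitions_reachable E E1 phi E2 :
  nielsen_transitions E (E1, phi, E2) -> reachable E E1 /\ reachable E E2.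
Proof. by case. Qed.

Definition nielsen_system (E : equation) (qE : quadratic E) :
    counter_system V equation :=
  {| states := reachable E;
     transitions := nielsen_transitions E;
     transitions_states := @nielsen_transitions_reachable E;
     states_finite := reachable_finite qE;
     transitions_finite := nielsen_transitions_finite qE |}.

End WordEquations.

(* Main.v *)
Require Import Defs.
From mathcomp Require Import all_boot.
From mathcomp Require Import boolp classical_sets functions cardinality.
From mathcomp Require Import zify.
From Stdlib Require Import Relation_Operators.

(** A transition out of [E1] is enabled at [v] exactly when the corresponding
    Nielsen step turns some solution of [E1] with lengths [v] into a solution of
    the target equation with the new counter values as lengths. Backwards along
    a run, this rebuilds a solution from the trivial equation, which is solved
    by words of any lengths since there is a constant. Forwards, a solution
    always enables some step, and [|sigma(L)|] plus the size of the equation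
    decreases: erasing and cancelling shrink the equation, the other rules
    shorten [sigma(L)], and no rule enlarges a quadratic equation. *)

Set Implicit Arguments.
Unset Strict Implicit.
Unset Printing Implicit Defensive.

Local Open Scope classical_set_scope.

(** * Meaning of the guard formulas *)

Section Guards.
Variable X : finType.
Implicit Types (x y z : X) (v w : X -> nat).

(** The recursive right-hand side lets the induction run over an arbitrary list, whose index type
    need not have decidable equality. *)
Lemma sat_big_And (F I : Type) (r : seq I) (P : pred I) (phi : I -> formula F)
    (e : F -> nat) :
  sat (\big[@And _/Top]_(i <- r | P i) phi i) e <->
  foldr (fun i Q => (P i -> sat (phi i) e) /\ Q) True r.
Proof.
elim: r => [|i r IH]; first by rewrite big_nil.
rewrite big_cons /=; case: (P i) => /=; rewrite IH; first by split=> -[]; auto.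
by split=> [|[]].
Qed.

Lemma sat_big_And_fin (F : Type) (P : pred X) (phi : X -> formula F)
    (e : F -> nat) :
  sat (\big[@And _/Top]_(x | P x) phi x) e <-> forall x, P x -> sat (phi x) e.
Proof.
rewrite sat_big_And; split=> [H x|H]; last by elim: (index_enum X) => /=; auto.
have := mem_index_enum x; elim: (index_enum X) H => //= y r IH [Hy /IH{}IH].
by rewrite inE => /predU1P[->|/IH].
Qed.

Lemma sat_ID v w : sat_update (ID X) v w <-> v =1 w.
Proof.
rewrite /sat_update sat_big_And_fin /=.
by split=> H x => [|_]; rewrite H.
Qed.

Lemma sat_ZERO y v w : sat_update (ZERO y) v w <-> v y = 0 /\ v =1 w.
Proof. by split=> -[? /sat_ID]. Qed.

Lemma sat_unchanged_except y v w :
  sat_update (unchanged_except y) v w <-> forall x, x != y -> w x = v x.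
Proof. exact: sat_big_And_fin. Qed.

(** Solved for the old values in terms of the new ones: no subtraction appears, and this is the form
    in which lengths are rebuilt backwards. *)
Lemma sat_DEC y v w :
  sat_update (DEC y) v w <-> v =1 [eta w with y |-> (w y).+1].
Proof.
split=> [[/= _ [eqy /sat_unchanged_except H]] x /=|H].
  by case: eqVneq => [->|/H //]; lia.
have /= := H y; rewrite eqxx => Hy; split=> /=; first by lia.
split=> /=; first by lia.
by apply/sat_unchanged_except => x /negbTE ne; rewrite H /= ne.
Qed.

(** As [z] differs from [y], its counter is unchanged, so [w z] can stand for the subtracted amount;
    [v z <= v y] then follows from the sum. *)
Lemma sat_SUB y z v w : z != y ->
  sat_update (SUB y z) v w <-> 0 < v z /\ v =1 [eta w with y |-> w z + w y].
Proof.
move=> zy; split.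
  case=> -[/= z_gt0 _] [eqy /sat_unchanged_except H]; split=> [|x /=]; first lia.
  by case: eqVneq => [->|/H //]; rewrite (H z zy); lia.
case=> z_gt0 H; have /= := H y; rewrite eqxx => Hy.
have /= := H z; rewrite (negbTE zy) => Hz.
split; split=> /=; [lia | lia | lia |].
by apply/sat_unchanged_except => x /negbTE ne; rewrite H /= ne.
Qed.

End Guards.

(** * Solutions as assignments, and single Nielsen steps *)

Section Valuations.
Variables A V : finType.
Implicit Types (E : equation A V) (g : V -> seq A) (u w : word A V) (x y : V).

Definition value g w : seq A :=
  flatten [seq match s with inl a => [:: a] | inr x => g x end | s <- w].

Definition solves g E : Prop := value g E.1 = value g E.2.

Definition lengths g : V -> nat := fun x => size (g x).

Lemma value_cat g u w : value g (u ++ w) = value g u ++ value g w.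
Proof. by rewrite /value map_cat flatten_cat. Qed.

Lemma value_const g a w : value g (inl a :: w) = a :: value g w.
Proof. by []. Qed.

Lemma value_var g x w : value g (inr x :: w) = g x ++ value g w.
Proof. by []. Qed.

Lemma value1 g x : value g [:: inr x] = g x.
Proof. exact: cats0. Qed.

Lemma eq_value g g' : g =1 g' -> value g =1 value g'.
Proof. by move=> H w; rewrite (funext H). Qed.

Lemma value_subst g y u w :
  value g (subst y u w) = value [eta g with y |-> value g u] w.
Proof.
elim: w => //= s w IH; have [->|ne] := eqVneq s (inr y).
  by rewrite subst_var value_cat IH value_var /= eqxx.
rewrite subst_other //; case: s ne => [a|x] ne; first by rewrite !value_const IH.
have {ne} /negbTE ne : x != y by apply: contraNneq ne => ->.
by rewrite !value_var IH /= ne.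
Qed.

Lemma value_subst_nil g y w : g y = [::] -> value g (subst y [::] w) = value g w.
Proof.
move=> gy; rewrite value_subst; apply: eq_value => x /=.
by case: eqVneq => [->|].
Qed.

(** A homomorphism fixing the constants is determined by its values at the variables, and [value g]
    extends any assignment [g] to one. *)
Lemma length_abstractionP E v :
  length_abstraction E v <-> exists2 g, solves g E & lengths g =1 v.
Proof.
split=> [[h [h0 hcat hconst hE] <-]|[g gE gv]].
  exists (fun x => h [:: inr x]) => //.
  suff hV w : value (fun x => h [:: inr x]) w = h w by rewrite /solves !hV.
  elim: w => [|s w IH]; rewrite ?h0 // -cat1s hcat value_cat IH.
  by case: s => [a|x]; rewrite ?hconst ?value1.
exists (value g); last by apply/funext => x; rewrite value1 -gv.
by split=> // u w; rewrite value_cat.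
Qed.

(** The stripped prefix is put back in front of the value of the rewritten variable; by
    [value_subst] this absorbs the substitution, and the guard says that the lengths grow
    accordingly. *)
Lemma nielsen_lift r E E' v g : nielsen r E E' ->
    sat_update (guard r) v (lengths g) -> solves g E' ->
  exists2 g', solves g' E & lengths g' =1 v.
Proof.
have lenE y (t : seq A) :
    lengths [eta g with y |-> t] =1 [eta lengths g with y |-> size t].
  by move=> x; rewrite /lengths /=; case: eqP.
rewrite /solves; case=> {r E E'} [x w1 w2|y w1 w2|s w1 w2|a y w1 w2|x b w1 w2
    |x y w1 w2 /eqP xy|x y w1 w2 /eqP xy] /=.
- case/sat_ZERO=> v0 vg; have gx : g x = [::].
    by apply/nilP; rewrite /nilp -[size _]/(lengths g x) -vg v0.
  by rewrite !value_subst_nil // => H; exists g => //; rewrite value_var gx.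
- case/sat_ZERO=> v0 vg; have gy : g y = [::].
    by apply/nilP; rewrite /nilp -[size _]/(lengths g y) -vg v0.
  by rewrite !value_subst_nil // => H; exists g => //; rewrite value_var gy.
- move=> /sat_ID vg H; exists g => //.
  by rewrite -cat1s -(cat1s s w2) !value_cat H.
- move=> /sat_DEC vg; rewrite value_var !value_subst value_const value1 => H.
  exists [eta g with y |-> a :: g y]; last by move=> x; rewrite lenE vg.
  by rewrite value_const H value_var /= eqxx.
- move=> /sat_DEC vg; rewrite value_var !value_subst value_const value1 => H.
  exists [eta g with x |-> b :: g x]; last by move=> y; rewrite lenE vg.
  by rewrite value_const -H value_var /= eqxx.
- move=> /(sat_SUB _ _ xy)[_ vg].
  rewrite value_var !value_subst value_var value1 => H.
  exists [eta g with y |-> g x ++ g y].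
    by rewrite !value_var H /= eqxx (negbTE xy) catA.
  by move=> z; rewrite lenE vg /= size_cat.
- rewrite eq_sym in xy; move=> /(sat_SUB _ _ xy)[_ vg].
  rewrite value_var !value_subst value_var value1 => H.
  exists [eta g with x |-> g y ++ g x].
    by rewrite !value_var -H /= eqxx (negbTE xy) catA.
  by move=> z; rewrite lenE vg /= size_cat.
Qed.

(* The value of both sides is measured so that the notion is symmetric. *)
Definition weight g E := size (value g E.1) + size (value g E.2) + Defs.total E.

Definition progress g E : Prop := exists r E' g',
  [/\ nielsen r E E', sat_update (guard r) (lengths g) (lengths g'),
      solves g' E' & weight g' E' < weight g E].

Lemma nielsen_swap r E E' : nielsen r E E' -> nielsen r (E.2, E.1) (E'.2, E'.1).
Proof. by case=> *; constructor; auto. Qed.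

(** Rules, guards and weight do not distinguish the sides, so each case below is treated in one
    orientation only. *)
Lemma progress_swap g E : progress g (E.2, E.1) -> progress g E.
Proof.
case=> r [E' [g' [/nielsen_swap st sr gE' lt]]]; exists r, (E'.2, E'.1), g'.
split=> //; first by case: E st {lt}.
by move: lt; rewrite /weight /Defs.total /=; lia.
Qed.

Lemma quadratic_swap E : quadratic E -> quadratic (E.2, E.1).
Proof. by move=> qE x; rewrite count_cat addnC -count_cat. Qed.

Lemma progress_erase g x w1 w2 :
  g x = [::] -> solves g (inr x :: w1, w2) -> progress g (inr x :: w1, w2).
Proof.
move=> gx; rewrite /solves /= value_var gx => gE.
exists (Erase x), (subst x [::] w1, subst x [::] w2), g; split.
- exact: Nielsen_erase_l.
- by apply/sat_ZERO; rewrite /lengths gx.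
- by rewrite /solves /= !value_subst_nil.
rewrite /weight /Defs.total /= !value_subst_nil // value_var gx /=.
by have /= := size_subst x [::] w1; have /= := size_subst x [::] w2; lia.
Qed.

Lemma progress_cancel g s w1 w2 :
  solves g (s :: w1, s :: w2) -> progress g (s :: w1, s :: w2).
Proof.
rewrite /solves /= -cat1s -(cat1s s w2) !value_cat => /eqP.
rewrite eqseq_cat // eqxx /= => /eqP gE.
exists (Cancel V), (w1, w2), g; split=> //; [exact: Nielsen_cancel|exact/sat_ID|].
by rewrite /weight /Defs.total /= -cat1s -(cat1s s w2) !value_cat !size_cat; lia.
Qed.

(* The new value [t] of [y] makes substituting [u] for [y] a change of
   variables from [g] to [g']. *)
Lemma value_strip g y t u : let g' := [eta g with y |-> t] in
  value g' u = g y -> forall w, value g' (subst y u w) = value g w.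
Proof.
move=> g' gu w; rewrite value_subst; apply: eq_value => x /=.
by case: eqVneq => [->|].
Qed.

Lemma progress_const g a y w1 w2 : quadratic (inl a :: w1, inr y :: w2) ->
    g y <> [::] -> solves g (inl a :: w1, inr y :: w2) ->
  progress g (inl a :: w1, inr y :: w2).
Proof.
move=> qE; rewrite /solves /= value_const value_var.
case gy: (g y) => [|b t] // _ [ab gE]; subst b.
pose g' := [eta g with y |-> t].
have st := Nielsen_const_l a y w1 w2.
have g'y : g' y = t by rewrite /g' /= eqxx.
have valE w : value g' (subst y [:: inl a; inr y] w) = value g w.
  by apply: value_strip; rewrite value_const value1 gy -/g' g'y.
exists (StripConst y), (subst y [:: inl a; inr y] w1,
    inr y :: subst y [:: inl a; inr y] w2), g'; split=> //.
- apply/sat_DEC => x; rewrite /lengths /= eqxx.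
  by case: eqVneq => [->|//]; rewrite gy.
- by rewrite /solves /= value_var !valE g'y.
(* Both values lose the letter [a]. Quadraticity leaves at most one occurrence of [y] beyond the
   head, so the dropped head pays for the inserted symbol. *)
have [_] := nielsen_bounded st qE.
rewrite /weight [fst _]/= [snd _]/= value_const !value_var !valE gy g'y.
by rewrite [size (a :: _)]/= [size ((a :: _) ++ _)]/=; lia.
Qed.

Lemma progress_var g x y w1 w2 : quadratic (inr x :: w1, inr y :: w2) ->
    x != y -> g x <> [::] -> size (g x) <= size (g y) ->
  solves g (inr x :: w1, inr y :: w2) -> progress g (inr x :: w1, inr y :: w2).
Proof.
move=> qE xy gx le; rewrite /solves /= !value_var => gE.
(* Both sides evaluate to the same word, so the shorter [g x] is a prefix of [g y] and [t] is what
   remains, possibly empty. *)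
pose t := drop (size (g x)) (g y).
have gy : g y = g x ++ t.
  have /(congr1 (take (size (g x)))) := gE.
  by rewrite take_size_cat // takel_cat // => {1}->; rewrite cat_take_drop.
have {}gE : value g w1 = t ++ value g w2.
  by apply/eqP; move/eqP: gE; rewrite gy -catA eqseq_cat // eqxx.
pose g' := [eta g with y |-> t].
have st := Nielsen_var_l w1 w2 (elimN eqP xy).
have g'y : g' y = t by rewrite /g' /= eqxx.
have g'x : g' x = g x by rewrite /g' /= (negbTE xy).
have valE w : value g' (subst y [:: inr x; inr y] w) = value g w.
  by apply: value_strip; rewrite value_var value1 -/g' g'x g'y.
have x_gt0 : 0 < size (g x) by rewrite lt0n size_eq0; apply/eqP.
exists (StripVar x y), (subst y [:: inr x; inr y] w1,
    inr y :: subst y [:: inr x; inr y] w2), g'; split=> //.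
- apply/sat_SUB => //; split=> // z; rewrite /lengths /= eqxx (negbTE xy).
  by case: eqVneq => [->|//]; rewrite gy size_cat.
- by rewrite /solves /= value_var !valE g'y.
have [_] := nielsen_bounded st qE.
rewrite /weight [fst _]/= [snd _]/= !value_var !valE gy g'y !size_cat.
lia.
Qed.

(** The two head symbols select the rule. A head variable with empty value is erased before any
    stripping, so that stripping always removes a letter. *)
Lemma solves_progress g E :
  quadratic E -> solves g E -> E <> ([::], [::]) -> progress g E.
Proof.
have er x w1 w2 : g x = [::] -> solves g (w1, inr x :: w2) ->
    progress g (w1, inr x :: w2).
  by move=> gx gE; apply/progress_swap/progress_erase.
case: E => -[|[a|x] w1] [|[b|y] w2] qE gE // _.
- by apply: er => //; move: gE; rewrite /solves /= value_var; case: (g y).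
- have [ab _] : a :: value g w1 = b :: value g w2 by [].
  by subst b; apply: progress_cancel.
- have [/er|gy] := eqVneq (g y) [::]; first exact.
  by apply: progress_const => //; apply/eqP.
- apply: progress_erase => //.
  by move: gE; rewrite /solves /= value_var; case: (g x).
- have [gx|gx] := eqVneq (g x) [::]; first exact: progress_erase.
  apply/progress_swap/progress_const => //; first exact: quadratic_swap qE.
  exact/eqP.
have [gx|/eqP gx] := eqVneq (g x) [::]; first exact: progress_erase.
have [/er|/eqP gy] := eqVneq (g y) [::]; first exact.
have [xy|xy] := eqVneq x y; first by subst y; apply: progress_cancel.
have [le|/ltnW le] := leqP (size (g x)) (size (g y)).
  exact: progress_var.
apply/progress_swap/progress_var => //; first exact: quadratic_swap qE.
by rewrite eq_sym.
Qed.

End Valuations.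

(** * Runs of the counter system *)

Section Runs.
Variables (A V : finType) (E : equation A V) (qE : quadratic E).
Local Notation C := (nielsen_system qE).

(** Only length vectors are carried along the run, because each step backwards may change the
    assignment. *)
Lemma run_solves (c c' : equation A V * (V -> nat)) :
    clos_refl_trans _ (cs_step C) c c' ->
  length_abstraction c'.1 c'.2 -> length_abstraction c.1 c.2.
Proof.
elim=> {c c'} [c c' [phi [[/= _ _ [r st ->]] sr]]|//|c1 c2 c3 _ IH1 _ IH2].
  move=> /length_abstractionP[g gE gv]; apply/length_abstractionP.
  by apply: nielsen_lift st _ gE; rewrite (funext gv).
by move/IH2/IH1.
Qed.

(** Strong induction on the weight. Reachability of [F] supplies both its quadraticity and its
    membership in the control states. *)
Lemma solves_run (F : equation A V) g : reachable E F -> solves g F ->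
  exists v, clos_refl_trans _ (cs_step C) (F, lengths g) ([::], [::], v).
Proof.
have [n] := ubnP (weight g F); elim: n F g => // n IH F g lt rF gF.
have [->|ne] := pselect (F = ([::], [::])).
  by exists (lengths g); apply: rt_refl.
have [qF _] := reachable_bounded qE rF.
have [r [F' [g' [st sr gF' lt']]]] := solves_progress qF gF ne.
have rF' : reachable E F' by apply: rt_trans rF _; apply: rt_step; exists r.
have [|v run] := IH F' g' _ rF' gF'; first exact: leq_trans lt' _.
exists v; apply: rt_trans run; apply: rt_step; exists (guard r).
by split=> //; split=> //; exists r.
Qed.

End Runs.

Theorem theorem2 (A V : finType) (hA : (0 < #|A|)%N)
    (E : equation A V) (qE : quadratic E) :
  length_abstraction E =
  [set v : V -> nat |
    pre_star (nielsen_system qE) ([set ([::], [::])] `*` setT) (E, v)].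
Proof.
have rE : reachable E E by apply: rt_refl.
apply/seteqP; split=> [v /length_abstractionP[g gE /funext <-]|v /=].
  have [w run] := solves_run qE rE gE.
  by split=> //; exists ([::], [::], w).
case=> _ [[F w] [/= -> _] /run_solves]; apply.
have /card_gt0P[a _] := hA.
(* Repeating the single letter [a] realises the arbitrary final vector [w]. *)
apply/length_abstractionP; exists (fun x => nseq (w x) a) => // x.
exact: size_nseq.
Qed.
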